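(* Let $A,B$ be finite sets, let $R$ be a Laurent-generated subsemiring of $\mathbb Z^A_{\mathrm{pos}}\cup\{-\infty\}$, and let $\{F_1,\dots,F_n\}$ be a Laurent-generating set of $R$. Let $$\mathcal A=\{\nu\mid\nu\text{ is a semiring homomorphism from }R\text{ to }\mathbb Z^B_{\mathrm{pos}}\cup\{-\infty\}\}$$ and let $\mathcal B$ be the set of all $(G_1,\dots,G_n)\in(\mathbb Z^B_0)^n$ such that for every $b\in B$ there exist $a\in A$ and a nonnegative rational number $t$ with $G_i(b)=tF_i(a)$ for all $i=1,\dots,n$. Then the map $$\mathcal A\to\mathcal B,\qquad\nu\mapsto(\nu(F_1),\dots,\nu(F_n))$$ is (well defined and) bijective.
   Context: Semirings are commutative with $0$ and $1$ ($0$ absorbing); semiring homomorphisms preserve $+,\cdot,0,1$; subsemirings contain the same $0,1$; $\langle S\rangle$ is the smallest subsemiring containing $S$. For a finite set $A$, $(\mathbb Z\cup\{-\infty\})^A$ is the semiring of maps $A\to\mathbb Z\cup\{-\infty\}$ with $(F\oplus G)(a)=\max\{F(a),G(a)\}$ and $(F\odot G)(a)=F(a)+G(a)$; its zero is the constant map $-\infty$ and its one is the constant map $0$. With $\deg F=\sum_{a\in A}F(a)$, put $\mathbb Z^A_{\mathrm{pos}}=\{F\mid\deg F\ge0\}$ and $\mathbb Z^A_0=\{F\mid\deg F=0\}$. Then $\mathbb Z^A_{\mathrm{pos}}\cup\{-\infty\}$ (with $-\infty$ the constant map) is a subsemiring whose group of multiplicative units is $\mathbb Z^A_0$. For a subset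 $S$ of the unit group of a semiring, the subsemiring $\langle S\cup S^{-1}\rangle$ is said to be Laurent-generated by $S$, and $S$ is called a Laurent-generating set of it. A Laurent-generated subsemiring is one Laurent-generated by some set. *)

(* Defs.v *)
From HB Require Import structures.
From mathcomp Require Import all_boot all_order all_algebra.
From mathcomp Require Import boolp classical_sets functions.

Set Implicit Arguments.
Unset Strict Implicit.
Unset Printing Implicit Defensive.

Import Order.TTheory GRing.Theory Num.Theory.

Local Open Scope classical_set_scope.
Local Open Scope ring_scope.

(* Z u {-oo} as an idempotent semiring: [None] is -oo, [+] is the maximum and
   [*] is the addition of integers, so that 0 = None and 1 = Some 0. *)
Definition maxZ := option int.

HB.instance Definition _ := Choice.on maxZ.

Definition maxZ_add (x y : maxZ) : maxZ :=
  match x, y with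
  | Some m, Some n => Some (Num.max m n)
  | None, _ => y
  | _, None => x
  end.

Definition maxZ_mul (x y : maxZ) : maxZ :=
  match x, y with
  | Some m, Some n => Some (m + n)
  | _, _ => None
  end.

Lemma maxZ_addA : associative maxZ_add.
Proof. by move=> [x|] [y|] [z|] //=; rewrite maxA. Qed.

Lemma maxZ_addC : commutative maxZ_add.
Proof. by move=> [x|] [y|] //=; rewrite maxC. Qed.

Lemma maxZ_add0 : left_id None maxZ_add.
Proof. by case. Qed.

HB.instance Definition _ :=
  GRing.isNmodule.Build maxZ maxZ_addA maxZ_addC maxZ_add0.

Lemma maxZ_mulA : associative maxZ_mul.
Proof. by move=> [x|] [y|] [z|] //=; rewrite addrA. Qed.

Lemma maxZ_mulC : commutative maxZ_mul.
Proof. by move=> [x|] [y|] //=; rewrite addrC. Qed.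

Lemma maxZ_mul1 : left_id (Some 0) maxZ_mul.
Proof. by case=> [x|] //=; rewrite add0r. Qed.

Lemma maxZ_mulDl : left_distributive maxZ_mul maxZ_add.
Proof. by move=> [x|] [y|] [z|] //=; rewrite addr_maxl. Qed.

Lemma maxZ_mul0 : left_zero None maxZ_mul.
Proof. by case. Qed.

HB.instance Definition _ :=
  GRing.Nmodule_isComPzSemiRing.Build maxZ
    maxZ_mulA maxZ_mulC maxZ_mul1 maxZ_mulDl maxZ_mul0.

(* [{ffun A -> maxZ}], with the pointwise operations of the library, is the
   semiring (Z u {-oo})^A; only commutativity has to be added.  For A empty it
   is the trivial semiring, in which 0 = 1. *)
Lemma maxZ_ffun_mulC (A : finType) :
  commutative (@GRing.mul {ffun A -> maxZ}).
Proof. by move=> f g; apply/ffunP => a; rewrite !ffunE mulrC. Qed.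

HB.instance Definition _ (A : finType) :=
  GRing.PzSemiRing_hasCommutativeMul.Build {ffun A -> maxZ}
    (@maxZ_ffun_mulC A).

Section IntegerMaps.
Variable A : finType.
Implicit Types F : {ffun A -> maxZ}.

(* The junk value of [zval] at -oo is never used below: it is only applied to
   integer-valued maps. *)
Definition zval (x : maxZ) : int := odflt 0 x.

Definition zvalued F : bool := [forall a, F a != None].

Definition deg F : int := \sum_(a : A) zval (F a).

Definition Zpos : {pred {ffun A -> maxZ}} :=
  [pred F | zvalued F && (0 <= deg F)].

Definition Zpos_inf : {pred {ffun A -> maxZ}} :=
  [pred F | (F \in Zpos) || (F == [ffun=> None])].

Definition Zzero : {pred {ffun A -> maxZ}} :=
  [pred F | zvalued F && (deg F == 0)].

Lemma Zpos_inf_semiring_closed : semiring_closed Zpos_inf.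
Proof.
have zS F a : zvalued F -> F a = Some (zval (F a)).
  by move/forallP => /(_ a); case: (F a).
have i0 : [ffun=> None] = 0 :> {ffun A -> maxZ}.
  by apply/ffunP => a; rewrite !ffunE.
split; split.
- by rewrite inE -i0 eqxx orbT.
- move=> F G /orP[/andP[zF dF]|/eqP->] hG; last by rewrite i0 add0r.
  move: hG => /orP[/andP[zG dG]|/eqP->]; last first.
    by rewrite i0 addr0; apply/orP; left; apply/andP.
  apply/orP; left; apply/andP; split.
    by apply/forallP => a; rewrite ffunE (zS F a zF) (zS G a zG).
  apply: (le_trans dF); apply: ler_sum => a _.
  by rewrite ffunE (zS F a zF) (zS G a zG) /= le_max lexx.
- apply/orP; left; apply/andP; split; first by apply/forallP => a; rewrite ffunE.
  by apply: sumr_ge0 => a _; rewrite ffunE.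
- move=> F G /orP[/andP[zF dF]|/eqP->] hG; last first.
    by rewrite i0 mul0r; apply/orP; right; rewrite i0.
  move: hG => /orP[/andP[zG dG]|/eqP->]; last first.
    by rewrite i0 mulr0; apply/orP; right; rewrite i0.
  apply/orP; left; apply/andP; split.
    by apply/forallP => a; rewrite ffunE (zS F a zF) (zS G a zG).
  suff -> : deg (F * G) = deg F + deg G by exact: addr_ge0.
  rewrite /deg -big_split /=; apply: eq_bigr => a _.
  by rewrite ffunE (zS F a zF) (zS G a zG).
Qed.

HB.instance Definition _ :=
  GRing.isSemiringClosed.Build _ Zpos_inf Zpos_inf_semiring_closed.

End IntegerMaps.

Section Subsemirings.
Variable S : comPzSemiRingType.

Definition subsemiring (R : semiringClosed S) := {x : S | x \in R}.

HB.instance Definition _ (R : semiringClosed S) :=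
  [isSub of subsemiring R for @sval S (fun x => x \in R)].
HB.instance Definition _ (R : semiringClosed S) :=
  [Choice of subsemiring R by <:].
HB.instance Definition _ (R : semiringClosed S) :=
  GRing.SubChoice_isSubComPzSemiRing.Build S _ (subsemiring R)
    (semiringClosedP R).

Definition generated_subsemiring (X : set S) : set S :=
  smallest (fun M : set S => semiring_closed (mem M)) X.

Definition unit_group : set S := [set x | exists y, x * y = 1].

Definition inverses (X : set S) : set S :=
  [set y | exists2 x, X x & x * y = 1].

Definition Laurent_generating_set (X : set S) (R : semiringClosed S) : Prop :=
  X `<=` unit_group /\
  [set` R] = generated_subsemiring (X `|` inverses X).

End Subsemirings.

(* Z^A_pos u {-oo} as a semiring. *)
Definition Zpos_semiring (A : finType) := subsemiring (@Zpos_inf A).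

HB.instance Definition _ (A : finType) :=
  GRing.SubComPzSemiRing.on (Zpos_semiring A).

Definition semiring_hom (S T : comPzSemiRingType) : set (S -> T) :=
  [set nu | nmod_morphism nu /\ monoid_morphism nu].

(* Main.v *)
From HB Require Import structures.
Require Import Defs.
From mathcomp Require Import all_boot all_order all_algebra.
From mathcomp Require Import boolp classical_sets functions.

(** A homomorphism into Z^B_pos u {-oo} is a family, indexed by b, of
    homomorphisms w to Z u {-oo}, so everything is decided one b at a time.
    Write f_a and g for the integer vectors (F_i(a))_i and (nu(F_i)(b))_i.  The
    claim is that g lies on the ray spanned by some f_a.

    Elements of R are maxima of Laurent monomials in the F_i.  The monomial with
    exponent vector m takes the value <m, f_a> at a, and w sends it to <m, g>.
    An inequality between elements of R can be tested on the f_a, and w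
    preserves it, as x <= y just says y + x = y.  If g were on no ray, each a
    would admit an exponent vector m_a with <m_a, g> <= 0 and
    <g, f_a> <= <m_a, f_a> ([ray_or_separated]: such an m_a is a multiple of the
    component of f_a orthogonal to g, or 0).  Then the monomial of exponent g is
    bounded by 1 + sum_a M(m_a) at every a, hence in R; applying w gives
    <g, g> <= 0, so g = 0.  But 0 is on every ray, and there is one, since A is
    nonempty: otherwise 0 = 1 in R ([points_on_rays]).  The maps nu(F_i) have
    degree 0 because they are units ([unit_Zzero]).

    Conversely, given b |-> (a, t) with G_i(b) = t F_i(a), set
    nu(x)(b) = t x(a).  Multiplication by t >= 0 commutes with maxima and sums.
    That t x(a) is an integer and that nu(x) has nonnegative degree hold for the
    generators and their inverses, and both properties pass to sums and products;
    induction over R ([Laurent_ind]) concludes.  The same induction shows that nu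
    is determined by the nu(F_i), inverses being unique. *)

Set Implicit Arguments.
Unset Strict Implicit.
Unset Printing Implicit Defensive.

Import Order.TTheory GRing.Theory Num.Theory.

Local Open Scope classical_set_scope.
Local Open Scope ring_scope.

(** * Arithmetic of the max-plus integers *)

Lemma maxZ_mul_eq1 (x y : maxZ) :
  x * y = 1 -> x = Some (zval x) /\ y = Some (- zval x).
Proof.
case: x y => [k|] [l|] //= [kl]; split => //.
by congr Some; apply/eqP; rewrite -subr_eq0 opprK addrC kl.
Qed.

Lemma maxZ_exprn (k : int) (m : nat) : (Some k : maxZ) ^+ m = Some (k *+ m).
Proof. by elim: m => // m IH; rewrite exprS IH mulrS. Qed.

Lemma maxZ_prod (I : finType) (f : I -> int) :
  \prod_i (Some (f i) : maxZ) = Some (\sum_i f i).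
Proof.
by rewrite (big_morph (@Some int : int -> maxZ) (id1 := 1) (op1 := *%R)).
Qed.

Lemma maxZ_add_le (k l : int) : k <= l -> (Some l : maxZ) + Some k = Some l.
Proof. by move=> kl; congr Some; apply/max_idPl. Qed.

(** * Separating an integer vector from a ray *)

Section Dot.
Variable n : nat.
Implicit Types f g m : 'I_n -> int.

Definition dot f g : int := \sum_i f i * g i.

Lemma dotC f g : dot f g = dot g f.
Proof. by apply: eq_bigr => i _; rewrite mulrC. Qed.

Lemma dot_comb (c d : int) f g h :
  dot (fun i => c * f i - d * g i) h = c * dot f h - d * dot g h.
Proof.
rewrite /dot !mulr_sumr -sumrB; apply: eq_bigr => i _.
by rewrite mulrBl !mulrA.
Qed.

Lemma dot_ge0 f : 0 <= dot f f.
Proof. by apply: sumr_ge0 => i _; rewrite -expr2 sqr_ge0. Qed.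

Lemma dot_eq0 f : dot f f = 0 -> forall i, f i = 0.
Proof.
have f2_ge0 i : true -> 0 <= f i * f i by rewrite -expr2 sqr_ge0.
move/(psumr_eq0P f2_ge0) => f0 i; apply/eqP.
by rewrite -sqrf_eq0 expr2 f0.
Qed.

(** If <g, f> <= 0 then m = 0 works.  Otherwise let l be |g|^2 times the
    component of f orthogonal to g.  If l = 0, then g is a positive multiple of
    f; if not, <l, f> > 0 = <l, g> and the multiple m = <g, f> l is long
    enough. *)
Lemma ray_or_separated f g :
  (exists2 t : rat, 0 <= t & forall i, (g i)%:~R = t * (f i)%:~R) \/
  (exists m, dot m g <= 0 /\ dot g f <= dot m f).
Proof.
have [fg_le0|fg_gt0] := leP (dot g f) 0.
  right; exists (fun=> 0).
  suff z h : dot (fun=> 0) h = 0 by rewrite !z.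
  by rewrite /dot big1 // => i _; rewrite mul0r.
pose l i := dot g g * f i - dot g f * g i.
have lg : dot l g = 0 by rewrite dot_comb (dotC f) mulrC subrr.
(* Since l is orthogonal to g, |l|^2 = |g|^2 <l, f>: the sign of <l, f> follows
   without appealing to the Cauchy-Schwarz inequality. *)
have ll : dot l l = dot g g * dot l f.
  by rewrite [LHS]dot_comb (dotC f) (dotC g l) lg mulr0 subr0.
have [l0|l_neq0] := eqVneq (dot l l) 0.
  left; exists ((dot g g)%:~R / (dot g f)%:~R).
    by rewrite divr_ge0 // ler0z ?dot_ge0 ?ltW.
  move=> i; have /eqP := dot_eq0 l0 i; rewrite subr_eq0 => /eqP lfg.
  have fg_neq0 : (dot g f)%:~R != 0 :> rat by rewrite intr_eq0 gt_eqF.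
  apply: (mulfI fg_neq0).
  by rewrite -intrM -lfg mulrA mulrCA divff // mulr1 intrM.
have lf_gt0 : 0 < dot l f.
  have : 0 < dot g g * dot l f by rewrite -ll lt_def l_neq0 dot_ge0.
  by apply: contraTT; rewrite -!leNgt => lf_le0; rewrite mulr_ge0_le0 ?dot_ge0.
right; exists (fun i => dot g f * l i).
have mE h : dot (fun i => dot g f * l i) h = dot g f * dot l h.
  by rewrite /dot mulr_sumr; apply: eq_bigr => i _; rewrite mulrA.
rewrite !mE lg mulr0; split => //.
by rewrite ler_peMr ?(ltW fg_gt0) // -gtz0_ge1.
Qed.

End Dot.

(** * Laurent monomials and homomorphisms to the max-plus integers *)

Section Monomials.
Variables (S : comPzSemiRingType) (n : nat) (u v : 'I_n -> S).

(** The k-th power of x, where y plays the role of the inverse of x. *)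
Definition laurent_exp (x y : S) (k : int) : S :=
  match k with Posz m => x ^+ m | Negz m => y ^+ m.+1 end.

Definition monomial (m : 'I_n -> int) : S :=
  \prod_i laurent_exp (u i) (v i) (m i).

Lemma rmorph_monomial (e : {rmorphism S -> maxZ}) (m : 'I_n -> int) :
  (forall i, u i * v i = 1) ->
  e (monomial m) = Some (dot m (fun i => zval (e (u i)))).
Proof.
move=> uv; rewrite rmorph_prod -maxZ_prod; apply: eq_bigr => i _.
have /maxZ_mul_eq1 [eu ev] : e (u i) * e (v i) = 1.
  by rewrite -rmorphM uv rmorph1.
case: (m i) => k; rewrite /laurent_exp rmorphXn ?ev 1?[LHS]eu.
  by rewrite eu maxZ_exprn -mulr_natl natz.
by rewrite maxZ_exprn NegzE mulNr -mulr_natl natz mulrN.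
Qed.

(** If w is off all rays, the element H = 1 + sum_a M(m_a) dominates the monomial
    M(g) under every [e a], although w sends H to the integer 0 and M(g) to |g|^2.
    This forces g = 0, and then any a and t = 0 put w on a ray; some a exists since
    otherwise joint injectivity would give 0 = 1, which w cannot respect. *)
Lemma points_on_rays (A : finType) (e : A -> {rmorphism S -> maxZ})
    (w : {rmorphism S -> maxZ}) :
  (forall i, u i * v i = 1) ->
  (forall x y, (forall a, e a x = e a y) -> x = y) ->
  exists a, exists2 t : rat, 0 <= t &
    forall i, (zval (w (u i)))%:~R = t * (zval (e a (u i)))%:~R.
Proof.
move=> uv e_inj; pose g i := zval (w (u i)); pose f a i := zval (e a (u i)).
have [//|off_rays] := pselect (exists a, exists2 t : rat, 0 <= t &
  forall i, (g i)%:~R = t * (f a i)%:~R).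
have /choice [m sep] a : exists m, dot m g <= 0 /\ dot g (f a) <= dot m (f a).
  by have [ray|//] := ray_or_separated (f a) g; case: off_rays; exists a.
pose H := 1 + \sum_a monomial (m a).
have H_absorbs : H + monomial g = H.
  apply: e_inj => a; rewrite /H (bigD1 a) //=.
  rewrite -addrA [_ + _ + monomial g]addrAC !rmorphD.
  congr (_ + (_ + _)).
  by rewrite !rmorph_monomial //; apply: maxZ_add_le; case: (sep a).
have wH : w H = 1.
  rewrite rmorphD rmorph1 rmorph_sum; apply: (big_ind (fun x => 1 + x = 1)).
  - by rewrite addr0.
  - by move=> x y x1 y1; rewrite addrA x1.
  - move=> a _; rewrite rmorph_monomial //.
    by apply: maxZ_add_le; case: (sep a).
have g0 : forall i, g i = 0.
  apply: dot_eq0; apply/eqP; rewrite eq_le dot_ge0 andbT.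
  have := congr1 w H_absorbs; rewrite rmorphD wH rmorph_monomial //.
  by case=> <-; rewrite le_max lexx orbT.
have [a _|A0] := pickP (@predT A).
  by case: off_rays; exists a, 0 => // i; rewrite g0 mul0r.
have /(congr1 w) : 0 = 1 :> S by apply: e_inj => a; have := A0 a.
by rewrite rmorph0 rmorph1.
Qed.

End Monomials.

(** * Dilations of the max-plus integers *)

(** Multiplication by t; the floor only makes the operation total, and it is
    the identity on [dilatable] arguments. *)
Definition dilate (t : rat) (x : maxZ) : maxZ :=
  omap (fun k : int => Num.floor (t * k%:~R)) x.

Definition dilatable (t : rat) (x : maxZ) : bool :=
  t * (zval x)%:~R \is a Num.int.

Lemma dilate_int (t : rat) (k l : int) :
  l%:~R = t * k%:~R -> dilate t (Some k) = Some l /\ dilatable t (Some k).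
Proof. by move=> tk; rewrite /dilatable /= -tk intrKfloor intr_int. Qed.

Lemma dilateD (t : rat) : 0 <= t -> {morph dilate t : x y / x + y}.
Proof.
move=> t0; have mono k l : k <= l ->
    dilate t (Some l) + dilate t (Some k) = dilate t (Some l).
  by move=> kl; apply/maxZ_add_le/le_floor/ler_wpM2l => //; rewrite ler_int.
move=> [k|] [l|] //; have [kl|/ltW lk] := leP k l.
  by rewrite [X in dilate t X]addrC [RHS]addrC mono ?maxZ_add_le.
by rewrite mono ?maxZ_add_le.
Qed.

Lemma dilateM (t : rat) (x y : maxZ) :
  dilatable t x -> dilate t (x * y) = dilate t x * dilate t y.
Proof.
by case: x y => [k|] [l|] //= tk; congr Some; rewrite intrD mulrDr floorDzr.
Qed.

Lemma dilatableD (t : rat) (x y : maxZ) :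
  dilatable t x -> dilatable t y -> dilatable t (x + y).
Proof.
case: x y => [k|] [l|] // tk tl.
by rewrite /dilatable /= maxEle; case: ifP.
Qed.

Lemma dilatableM (t : rat) (x y : maxZ) :
  dilatable t x -> dilatable t y -> dilatable t (x * y).
Proof.
case: x y => [k|] [l|] // tk tl.
by rewrite /dilatable /= intrD mulrDr rpredD.
Qed.

(** * Coordinates and units of the semiring of maps of nonnegative degree *)

Section ZposUnits.
Variable A : finType.
Implicit Types x y : Zpos_semiring A.

Definition coord (a : A) (x : Zpos_semiring A) : maxZ := \val x a.

Lemma coord_nmod_morphism a : nmod_morphism (coord a).
Proof. by split=> [|x y]; rewrite /coord ?raddf0 ?raddfD ffunE. Qed.

Lemma coord_monoid_morphism a : monoid_morphism (coord a).
Proof. by split=> [|x y]; rewrite /coord ?rmorph1 ?rmorphM ffunE. Qed.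

HB.instance Definition _ a :=
  GRing.isNmodMorphism.Build _ _ (coord a) (coord_nmod_morphism a).
HB.instance Definition _ a :=
  GRing.isMonoidMorphism.Build _ _ (coord a) (coord_monoid_morphism a).

Lemma coord_inj x y : (forall a, coord a x = coord a y) -> x = y.
Proof. by move=> xy; apply/val_inj/ffunP => a; apply: xy. Qed.

Lemma coord_unit x y : x * y = 1 ->
  forall a, coord a x = Some (zval (coord a x)) /\
            coord a y = Some (- zval (coord a x)).
Proof.
by move=> xy a; apply: maxZ_mul_eq1; rewrite -rmorphM xy rmorph1.
Qed.

Lemma deg_ge0 x : 0 <= deg (\val x).
Proof.
have /orP[/andP[_ //]|/eqP ->] := valP x.
by apply: sumr_ge0 => a _; rewrite ffunE.
Qed.

(** The degrees of x and of its inverse are opposite and both nonnegative. *)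
Lemma unit_Zzero x y : x * y = 1 -> \val x \in @Zzero A.
Proof.
move=> /coord_unit xy; apply/andP; split.
  by apply/forallP => a; case: (xy a); rewrite /coord => ->.
rewrite eq_le deg_ge0 andbT -oppr_ge0 -sumrN.
rewrite (eq_bigr (fun a => zval (\val y a))); first exact: deg_ge0.
by move=> a _; case: (xy a) => _; rewrite /coord => ->.
Qed.

Implicit Types f g : {ffun A -> maxZ}.

Lemma Zzero_Zpos_inf f : f \in @Zzero A -> f \in @Zpos_inf A.
Proof. by move=> /andP[zf /eqP f0]; rewrite !inE zf f0. Qed.

Lemma Zzero_opp f g :
  (forall a, g a = Some (- zval (f a))) -> f \in @Zzero A -> g \in @Zzero A.
Proof.
move=> gf /andP[_ /eqP f0]; rewrite inE; apply/andP; split.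
  by apply/forallP => a; rewrite gf.
rewrite /deg (eq_bigr (fun a => - zval (f a))) => [|a _]; last by rewrite gf.
by rewrite sumrN -/(deg f) f0 oppr0.
Qed.

End ZposUnits.

(** * Induction over a Laurent-generated subsemiring *)

Section LaurentInduction.
Variables (S : comPzSemiRingType) (R : semiringClosed S).
Variables (I : Type) (F : I -> subsemiring R).
Hypothesis genF : Laurent_generating_set [set \val (F i) | i in [set: I]] R.

Lemma Laurent_inverse i : exists y : subsemiring R, F i * y = 1.
Proof.
have [Funit RF] := genF.
have XF : [set \val (F i) | i in [set: I]] (\val (F i)) by exists i.
have [y Fy] := Funit _ XF.
have Ry : y \in R.
  have : [set` R] y; last by [].
  by rewrite RF; apply: sub_gen_smallest; right; exists (\val (F i)).
by exists (Sub y Ry); apply: val_inj; rewrite rmorphM rmorph1.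
Qed.

Lemma Laurent_ind (P : subsemiring R -> Prop) :
  P 0 -> P 1 ->
  (forall x y, P x -> P y -> P (x + y)) ->
  (forall x y, P x -> P y -> P (x * y)) ->
  (forall i y, F i * y = 1 -> P (F i) /\ P y) ->
  forall x, P x.
Proof.
move=> P0 P1 PD PM PF x; have [_ RF] := genF.
(* Generation is a property of subsets of S, so P is transported there. *)
pose Q : set S := [set y | exists2 z, P z & \val z = y].
suff [z Pz /val_inj <- //] : Q (\val x).
have : [set` R] (\val x) by exact: valP.
rewrite RF; apply: smallest_sub.
  split; split.
  - by apply/mem_set; exists 0; rewrite ?rmorph0.
  - move=> _ _ /set_mem[y Py <-] /set_mem[z Pz <-].
    by apply/mem_set; exists (y + z); [exact: PD|rewrite rmorphD].
  - by apply/mem_set; exists 1; rewrite ?rmorph1.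
  - move=> _ _ /set_mem[y Py <-] /set_mem[z Pz <-].
    by apply/mem_set; exists (y * z); [exact: PM|rewrite rmorphM].
have PFi i : P (F i) by have [y /PF[]] := Laurent_inverse i.
move=> y [[i _ <-]|[_ [i _ <-] Fy]]; first by exists (F i).
have [z Fz] := Laurent_inverse i; exists z; first by have [] := PF i z Fz.
(* The two inverses of F i, z in R and the given one in S, coincide. *)
have vFz : \val (F i) * \val z = 1 by rewrite -rmorphM Fz rmorph1.
by rewrite -[LHS]mulr1 -Fy mulrCA mulrA vFz mul1r.
Qed.

End LaurentInduction.

(** * Homomorphisms as configurations of points on rays *)

Theorem corollary4p2 (A B : finType) (R : semiringClosed (Zpos_semiring A))
    (n : nat) (F : 'I_n -> subsemiring R)
    (hF : Laurent_generating_set [set \val (F i) | i in [set: 'I_n]] R) :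
  set_bij
    (@semiring_hom (subsemiring R) (Zpos_semiring B))
    [set G : 'I_n -> Zpos_semiring B |
      (forall i, \val (G i) \in @Zzero B) /\
      (forall b : B, exists a : A, exists2 t : rat, 0 <= t &
         forall i, (zval (\val (G i) b))%:~R =
                   t * (zval (\val (\val (F i)) a))%:~R)]
    (fun nu i => nu (F i)).
Proof.
have /choice [Finv FK] := Laurent_inverse hF.
split.
- move=> nu [nuD nuM].
  pose nuD_mixin := GRing.isNmodMorphism.Build _ _ nu nuD.
  pose nuM_mixin := GRing.isMonoidMorphism.Build _ _ nu nuM.
  pose nu' : {rmorphism subsemiring R -> Zpos_semiring B} :=
    HB.pack nu nuD_mixin nuM_mixin.
  split=> [i|b].
    by apply: (@unit_Zzero _ _ (nu (Finv i))); rewrite -nuM.2 FK nuM.1.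
  apply: (points_on_rays (e := fun a => coord a \o \val)
                         (coord b \o nu') FK) => x y xy.
  by apply: val_inj; apply: coord_inj.
- move=> nu mu; rewrite !inE.
  move=> -[[nu0 nuD] [nu1 nuM]] [[mu0 muD] [mu1 muM]] numu.
  apply/funext; apply: (Laurent_ind hF); rewrite ?nu0 ?nu1 //.
  + by move=> x y xE yE; rewrite nuD muD xE yE.
  + by move=> x y xE yE; rewrite nuM muM xE yE.
  + move=> i y Fy; have FE : nu (F i) = mu (F i) by apply: (congr1 (@^~ i) numu).
    split=> //.
    by rewrite -[LHS]mulr1 -mu1 -Fy muM -FE mulrCA mulrA -nuM Fy nu1 mul1r.
- move=> G [G0 /choice[a]].
  move=> rays; have {rays} /choice [t ray] b : exists t : rat, 0 <= t /\
      forall i, (zval (\val (G i) b))%:~R =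
                t * (zval (\val (\val (F i)) (a b)))%:~R.
    by have [t] := rays b; exists t.
  pose Phi (x : subsemiring R) : {ffun B -> maxZ} :=
    [ffun b => dilate (t b) (coord (a b) (\val x))].
  pose integral (x : subsemiring R) b := dilatable (t b) (coord (a b) (\val x)).
  have t0 b : 0 <= t b by case: (ray b).
  have Phi0 : Phi 0 = 0 by apply/ffunP => b; rewrite !ffunE !rmorph0.
  have PhiD x y : Phi (x + y) = Phi x + Phi y.
    by apply/ffunP => b; rewrite !ffunE !rmorphD dilateD.
  have PhiM x y : (forall b, integral x b) -> Phi (x * y) = Phi x * Phi y.
    move=> intx; apply/ffunP => b.
    by rewrite !ffunE !rmorphM dilateM //; apply: intx.
  have int1 b : dilate (t b) 1 = 1 /\ dilatable (t b) 1.
    by apply: dilate_int; rewrite mulr0.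
  have Phi1 : Phi 1 = 1.
    by apply/ffunP => b; rewrite !ffunE !rmorph1 (int1 b).1.
  have PhiF i b : dilate (t b) (coord (a b) (\val (F i))) = \val (G i) b /\
                  integral (F i) b.
    have vFi : \val (F i) * \val (Finv i) = 1 by rewrite -rmorphM FK rmorph1.
    have [zG _] := andP (G0 i); have := forallP zG b.
    have [_ /(_ i)] := ray b; rewrite /integral.
    have [-> _] := coord_unit vFi (a b).
    by case: (\val (G i) b) => // k kE _; apply: dilate_int kE.
  have goodR x : (forall b, integral x b) /\ Phi x \in @Zpos_inf B.
    elim/(Laurent_ind hF): x =>
      [||x y [ix zx] [iy zy]|x y [ix zx] [iy zy]|i y Fy].
    + rewrite Phi0 rpred0; split=> // b.
      by rewrite /integral !rmorph0 /dilatable mulr0.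
    + rewrite Phi1 rpred1; split=> // b.
      by rewrite /integral !rmorph1; case: (int1 b).
    + rewrite PhiD rpredD //; split=> // b.
      by rewrite /integral !rmorphD dilatableD //; [exact: ix|exact: iy].
    + rewrite PhiM // rpredM //; split=> // b.
      by rewrite /integral !rmorphM dilatableM //; [exact: ix|exact: iy].
    + have PhiFG : Phi (F i) = \val (G i).
        by apply/ffunP => b; rewrite ffunE; case: (PhiF i b).
      split.
        by rewrite PhiFG Zzero_Zpos_inf //; split=> // b; case: (PhiF i b).
      have vFy : \val (F i) * \val y = 1 by rewrite -rmorphM Fy rmorph1.
      have Phiy b : dilate (t b) (coord (a b) (\val y)) =
                    Some (- zval (\val (G i) b)) /\ integral y b.
        rewrite /integral; have [_ ->] := coord_unit vFy (a b).
        have [_ /(_ i) E] := ray b.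
        by apply: dilate_int; rewrite !mulrNz E mulrN.
      split=> [b|]; first by case: (Phiy b).
      apply/Zzero_Zpos_inf/(Zzero_opp _ (G0 i)) => b.
      by rewrite ffunE; case: (Phiy b).
  pose nu (x : subsemiring R) : Zpos_semiring B := Sub (Phi x) (goodR x).2.
  exists nu; first split; first split.
  + by apply: val_inj; rewrite rmorph0.
  + by move=> x y; apply: val_inj; rewrite rmorphD; apply: PhiD.
  + split; first by apply: val_inj; rewrite rmorph1.
    move=> x y; apply: val_inj; rewrite rmorphM; apply: PhiM.
    by case: (goodR x).
  + apply/funext => i; apply/val_inj/ffunP => b; rewrite /= ffunE.
    by case: (PhiF i b).
Qed.
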